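(* Let $\mathbb{S}$ be Sacks forcing. Let $p \in \mathbb{S}$ be a condition and let $\dot{\tau}$ be an $\mathbb{S}$-name such that $p \Vdash \dot{\tau} : \omega \to {}^{\omega}\omega$. Then there exist a condition $q \le p$ and an object $\mathcal{W} = \langle \mathcal{F}, I \rangle$ in the ground model such that $$q \Vdash \check{\mathcal{W}} \text{ is a shrink wrapper for } \langle \dot{\tau}(n) : n \in \omega \rangle.$$ In particular, the shrink wrapping property holds between the ground model and every Sacks forcing extension.
   Context: Sacks forcing $\mathbb{S}$ is the set of perfect trees $p \subseteq {}^{<\omega}2$ (nonempty trees such that every node has two incompatible extensions in $p$), ordered by inclusion ($p_1 \le p_2$ iff $p_1 \subseteq p_2$). A function $f:\omega\to\omega\setminus\{0\}$ is given. A tree $T \subseteq {}^{<\omega}\omega$ obeys $f$ if for each $l\in\omega$ the set $\{n\in\omega : t^\frown n\in T \text{ for some } t \text{ on level } l \text{ of } T\}$ has size at most $f(l)$. Fixed throughout (in the ground model): a sequence $\langle f_i : i<\omega\rangle$ of functions $f_i:\omega\to\omega\setminus\{0\}$ such that $(i,l)\mapsto f_i(l)$ is computable and finite-to-one; a computable bijection $\eta:\omega\to[\omega]^2$ (so $\eta(\tilde n)$ is the $\tilde n$-th unordered pair); and a finite-to-one function $\Phi:{}^{<\omega}2\times\omega\to\omega$. A shrink wrapper for a sequence of reals $\mathcal{X}=\langle x_n : n\in\omega\rangle$ (each $x_n\in{}^\omega\omega$) is a pair $\langle\mathcal{F},I\rangle$ where $I:\omega\to[{}^\omega\omega]^{<\omega}$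 and $\mathcal{F}$ is a family of functions $F_{\tilde n,n}$ for $\tilde n\in\omega$, $n\in\eta(\tilde n)$, such that: 1) $F_{\tilde n,n}:{}^{\tilde n}2\to\mathcal{P}({}^{<\omega}\omega)$ and for each $s\in{}^{\tilde n}2$, $F_{\tilde n,n}(s)$ is a leafless tree obeying $f_{\Phi(s,n)}$; 2) for each $\tilde n$ and $n\in\eta(\tilde n)$ there is $s\in{}^{\tilde n}2$ with $x_n\in[F_{\tilde n,n}(s)]$; 3) for $\{n_1,n_2\}=\eta(\tilde n)$ and all $s_1,s_2\in{}^{\tilde n}2$, letting $C_1=[F_{\tilde n,n_1}(s_1)]$ and $C_2=[F_{\tilde n,n_2}(s_2)]$, one of the following holds: (a) $C_1=C_2$, and if $x_{n_1}\in C_1$ or $x_{n_2}\in C_2$ then $x_{n_1}=x_{n_2}$; (b) there is $x\in I(n_1)\cap I(n_2)$ with $C_1=C_2=\{x\}$; (c) $C_1\cap C_2=\emptyset$. Here $[T]$ denotes the set of infinite branches of $T$. The shrink wrapping property holds between a model $M$ and $V$ iff every sequence of reals in $V$ has a shrink wrapper in $M$. *)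

(* Defs.v *)
From mathcomp Require Import all_boot finmap.
From mathcomp Require Import boolp classical_sets functions cardinality.

Set Implicit Arguments.
Unset Strict Implicit.
Unset Printing Implicit Defensive.

Local Open Scope classical_set_scope.

(** Kleene's mu-recursive functions: codes and their (partial, deterministic)
    big-step evaluation on lists of arguments. *)
Inductive recfun : Type :=
| RZero
| RSucc
| RProj (i : nat)
| RComp (g : recfun) (hs : seq recfun)
| RRec (g h : recfun)
| RMu (g : recfun).

Inductive reval : recfun -> seq nat -> nat -> Prop :=
| reval_zero xs : reval RZero xs 0
| reval_succ x xs : reval RSucc (x :: xs) x.+1
| reval_proj i xs : i < size xs -> reval (RProj i) xs (nth 0 xs i)
| reval_comp g hs xs ys y :
    size ys = size hs ->
    (forall i, i < size hs -> reval (nth RZero hs i) xs (nth 0 ys i)) ->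
    reval g ys y -> reval (RComp g hs) xs y
| reval_rec0 g h xs y : reval g xs y -> reval (RRec g h) (0 :: xs) y
| reval_recS g h n xs y z :
    reval (RRec g h) (n :: xs) y -> reval h [:: n, y & xs] z ->
    reval (RRec g h) (n.+1 :: xs) z
| reval_mu g xs n (w : nat -> nat) :
    (forall m, m < n -> reval g (m :: xs) (w m).+1) ->
    reval g (n :: xs) 0 -> reval (RMu g) xs n.

Definition computable1 (g : nat -> nat) : Prop :=
  exists c, forall x, reval c [:: x] (g x).

Definition computable2 (g : nat -> nat -> nat) : Prop :=
  exists c, forall x y, reval c [:: x; y] (g x y).

(** An unordered pair is coded by listing its two elements. *)
Definition computable_pairs (eta : nat -> {fset nat}) : Prop :=
  exists a b : nat -> nat, [/\ computable1 a, computable1 b &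
    forall k, eta k = [fset a k; b k]%fset].

Definition unordered_pairs : set {fset nat} := [set e | #|` e| = 2].

Definition finite_to_one (T : Type) (g : T -> nat) : Prop :=
  forall m, finite_set (g @^-1` [set m]).

Definition is_tree (A : eqType) (T : set (seq A)) : Prop :=
  forall s t, prefix s t -> T t -> T s.

Definition leafless (A : eqType) (T : set (seq A)) : Prop :=
  forall t, T t -> exists a, T (rcons t a).

Definition obeys (T : set (seq nat)) (f : nat -> nat) : Prop :=
  forall l,
    ([set n | exists t, [/\ T t, size t = l & T (rcons t n)]] #<= `I_(f l))%card.

Definition perfect_tree (p : set (seq bool)) : Prop :=
  [/\ is_tree p, p !=set0 &
      forall t, p t -> exists t1 t2,
        [/\ p t1, p t2, prefix t t1 /\ prefix t t2 &
            ~~ prefix t1 t2 /\ ~~ prefix t2 t1]].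

Record sacks : Type := Sacks {
  sacks_tree :> set (seq bool);
  sacks_perfect : perfect_tree sacks_tree }.

Definition sacks_le (p q : sacks) : Prop := sacks_tree p `<=` sacks_tree q.

Lemma perfect_setT : perfect_tree setT.
Proof.
split=> //; first by exists [::].
move=> t _; exists (rcons t true), (rcons t false).
have incomp b c : b != c -> ~~ prefix (rcons t b) (rcons t c).
  by move=> bc; rewrite prefixE size_rcons -(size_rcons t c) take_size eqseq_rcons eqxx eq_sym.
by split=> //; rewrite ?prefix_rcons ?incomp.
Qed.

Definition sacks_top : sacks := Sacks perfect_setT.

(** The ambient type theory plays the role of the ground model V.  A formula of
    the forcing language is represented by the set of conditions forcing it, and
    the connectives below are the usual recursive clauses of the definition of
    forcing.  Quantifiers may range over [name], i.e. over the whole extension,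
    or over a type A of ground-model objects; the latter is the quantifier
    bounded by the check-name of A, since p forces "for all x in A^v, phi(x)"
    iff p forces phi(a^v) for every a in A. *)

Definition formula : Type := sacks -> Prop.

Definition forces (p : sacks) (phi : formula) : Prop := phi p.

Definition f_and (phi psi : formula) : formula := fun p => phi p /\ psi p.

Definition f_or (phi psi : formula) : formula := fun p =>
  forall q, sacks_le q p -> exists r, sacks_le r q /\ (phi r \/ psi r).

Definition f_imp (phi psi : formula) : formula := fun p =>
  forall q, sacks_le q p -> phi q -> psi q.

Definition f_all (A : Type) (phi : A -> formula) : formula := fun p =>
  forall a, phi a p.

Definition f_ex (A : Type) (phi : A -> formula) : formula := fun p =>
  forall q, sacks_le q p -> exists r, sacks_le r q /\ exists a, phi a r.

(** A ground-model assertion, used only for assertions that are absolute between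
    the ground model and its extensions. *)
Definition f_ground (Q : Prop) : formula := fun _ => Q.

Definition f_not (phi : formula) : formula := f_imp phi (f_ground False).

Definition f_iff (phi psi : formula) : formula :=
  f_and (f_imp phi psi) (f_imp psi phi).

Declare Scope forcing_scope.
Delimit Scope forcing_scope with forcing.
Bind Scope forcing_scope with formula.

Notation "p ||- phi" := (forces p phi%forcing)
  (at level 70, phi at next level, no associativity).
Notation "phi '&&&' psi" := (f_and phi psi)
  (at level 80, right associativity) : forcing_scope.
Notation "phi '|||' psi" := (f_or phi psi)
  (at level 85, right associativity) : forcing_scope.
Notation "phi '==>>' psi" := (f_imp phi psi)
  (at level 90, right associativity) : forcing_scope.
Notation "phi '<==>>' psi" := (f_iff phi psi)
  (at level 95, no associativity) : forcing_scope.
Notation "'\A' x .. y , phi" := (f_all (fun x => .. (f_all (fun y => phi)) ..))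
  (at level 200, x binder, y binder, right associativity) : forcing_scope.
Notation "'\E' x .. y , phi" := (f_ex (fun x => .. (f_ex (fun y => phi)) ..))
  (at level 200, x binder, y binder, right associativity) : forcing_scope.

Local Open Scope forcing_scope.

(** An S-name is a set of pairs (S-name, condition), here given as a family. *)
Inductive name : Type :=
  Name (A : Type) (elt : A -> name) (cond : A -> sacks).

(** "s belongs to the generic filter"; Sacks forcing is separative, so p forces
    this iff p <= s. *)
Definition f_generic (s : sacks) : formula := fun p => sacks_le p s.

Fixpoint f_eq (a b : name) : formula :=
  match a, b with
  | Name A x s, Name B y t =>
      (\A i : A, f_generic (s i) ==>>
         \E j : B, f_generic (t j) &&& f_eq (x i) (y j)) &&&
      (\A j : B, f_generic (t j) ==>>
         \E i : A, f_generic (s i) &&& f_eq (x i) (y j))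
  end.

Definition f_mem (a b : name) : formula :=
  match b with
  | Name B y t => \E j : B, f_generic (t j) &&& f_eq a (y j)
  end.

Definition name_of (A : Type) (elt : A -> name) : name :=
  Name elt (fun=> sacks_top).

(** check-name of the von Neumann natural number: n + 1 is n together with {n} *)
Fixpoint nat_check (n : nat) : name :=
  match n with
  | 0 => name_of (of_void name)
  | m.+1 => let: Name A x s := nat_check m in
            Name (fun o : option A => if o is Some i then x i else nat_check m)
                 (fun o => if o is Some i then s i else sacks_top)
  end.

Definition omega : name := name_of nat_check.

Definition upair (a b : name) : name := name_of (fun c : bool => if c then a else b).

Definition opair (a b : name) : name := upair (upair a a) (upair a b).

Definition real_check (x : nat -> nat) : name :=
  name_of (fun k => opair (nat_check k) (nat_check (x k))).

(** "g is a function from the set A to the class B" *)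
Definition is_function (g A : name) (B : name -> formula) : formula :=
  (\A z : name, f_mem z g ==>>
     \E a b : name, f_mem a A &&& B b &&& f_eq z (opair a b)) &&&
  (\A a : name, f_mem a A ==>> \E b : name, f_mem (opair a b) g) &&&
  (\A a b c : name, f_mem (opair a b) g ==>> f_mem (opair a c) g ==>> f_eq b c).

Definition is_real (x : name) : formula :=
  is_function x omega (fun m => f_mem m omega).

Definition is_real_sequence (tau : name) : formula :=
  is_function tau omega is_real.

Definition is_value (tau : name) (n : nat) (x : name) : formula :=
  f_mem (opair (nat_check n) x) tau.

(** The branches of T that exist in the extension, not only those of the ground
    model. *)
Definition in_branches (T : set (seq nat)) (x : name) : formula :=
  is_real x &&&
  \A k : nat, \E t : seq nat, f_ground (T t /\ size t = k) &&&
    \A i : nat, f_ground (i < k) ==>>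
      f_mem (opair (nat_check i) (nat_check (nth 0 t i))) x.

Definition same_branches (T1 T2 : set (seq nat)) : formula :=
  \A y : name, in_branches T1 y <==>> in_branches T2 y.

Definition only_branch (T : set (seq nat)) (x : nat -> nat) : formula :=
  \A y : name, in_branches T y <==>> f_eq y (real_check x).

Definition disjoint_branches (T1 T2 : set (seq nat)) : formula :=
  \A y : name, f_not (in_branches T1 y &&& in_branches T2 y).

(** The underlying pair <F, I> of ground-model objects; [wrap_F W k n] is only
    relevant for n in eta(k). *)
Record wrapper : Type := Wrapper {
  wrap_F : forall k : nat, nat -> k.-tuple bool -> set (seq nat);
  wrap_I : nat -> set (nat -> nat) }.

Section ShrinkWrapper.

Variables (f : nat -> nat -> nat) (eta : nat -> {fset nat})
          (Phi : seq bool * nat -> nat).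

(** The requirements on <F, I> that do not mention the sequence of reals.  They
    only involve natural numbers, finite sequences and finiteness of sets of the
    ground model, hence are absolute. *)
Definition wrapper_shape (W : wrapper) : Prop :=
  (forall n, finite_set (wrap_I W n)) /\
  (forall k n (s : k.-tuple bool), n \in eta k ->
     [/\ is_tree (wrap_F W n s), leafless (wrap_F W n s) &
         obeys (wrap_F W n s) (f (Phi (tval s, n)))]).

Definition is_shrink_wrapper (W : wrapper) (tau : name) : formula :=
  is_real_sequence tau &&&
  f_ground (wrapper_shape W) &&&
  (\A k n : nat, f_ground (n \in eta k) ==>>
     \E s : k.-tuple bool, \A x : name,
       is_value tau n x ==>> in_branches (wrap_F W n s) x) &&&
  (\A k n1 n2 : nat, f_ground (eta k = [fset n1; n2]%fset) ==>>
     \A s1 s2 : k.-tuple bool, \A x1 x2 : name,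
       is_value tau n1 x1 ==>> is_value tau n2 x2 ==>>
       let C1 := wrap_F W n1 s1 in
       let C2 := wrap_F W n2 s2 in
         (same_branches C1 C2 &&&
            (in_branches C1 x1 ||| in_branches C2 x2 ==>> f_eq x1 x2))
     ||| (\E x : nat -> nat, f_ground (wrap_I W n1 x /\ wrap_I W n2 x) &&&
            only_branch C1 x &&& only_branch C2 x)
     ||| disjoint_branches C1 C2).

(** Evaluated in the extension; the quantifier over W ranges over the ground
    model.  It holds in every Sacks extension iff [sacks_top] forces it. *)
Definition shrink_wrapping_property : formula :=
  \A tau : name, is_real_sequence tau ==>>
    \E W : wrapper, is_shrink_wrapper W tau.

End ShrinkWrapper.

(* Main.v *)
(** Fusion.  Write x_n for the n-th real named by tau.  At stage k there is one
    condition P_s for each s in 2^k; each P_s is shrunk so that, for the two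
    elements n of eta(k),
    - the possible values of x_n(l) below P_s number at most f_{Phi(s,n)}(l), by
      the Sacks property: each f_i is finite-to-one, hence tends to infinity, so
      a fusion with sparse enough splitting stays under it;
    - P_s either decides x_n or forces it outside the ground model;
    - for two slots (s,n) and (s',n'), either some level l separates the possible
      values of x_n(l) below P_s from those of x_n'(l) below P_s', or both are
      decided to be the same ground-model real, or s = s' and P_s forces
      x_n = x_n'.
    These properties survive further shrinking, so they hold for the conditions
    Q_s below the fusion q.  F_{k,n}(s) is the tree of possible initial segments
    of x_n below Q_s, and I(n) is the set of ground-model reals that some r <= q
    decides x_n to be; it is finite because the 2^k conditions Q_s are predense
    below q.  The three cases for a pair of slots give (c), (b) and (a).  In case
    (a), if x_n is not decided, every other Q_s' is separated from F_{k,n}(s), so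
    x_n in [F_{k,n}(s)] forces the generic through Q_s. *)

Require Import Defs.
From mathcomp Require Import all_boot finmap.
From mathcomp Require Import boolp classical_sets functions cardinality.

Set Implicit Arguments.
Unset Strict Implicit.
Unset Printing Implicit Defensive.

Local Open Scope classical_set_scope.

(** * Perfect trees *)

Definition comparable (u v : seq bool) := prefix u v || prefix v u.

Lemma comparable_sym u v : comparable u v = comparable v u.
Proof. exact: orbC. Qed.

Lemma prefixes_comparable u v w : prefix u w -> prefix v w -> comparable u v.
Proof.
wlog uv : u v / size u <= size v.
  by move=> W pu pv; case/orP: (leq_total (size u) (size v)) => ?;
    [|rewrite comparable_sym]; exact: W.
rewrite !prefixE => /eqP pu /eqP pv.
by apply/orP; left; rewrite prefixE -pv take_takel // pu.
Qed.

Lemma comparable_leq u v : comparable u v -> size u <= size v -> prefix u v.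
Proof.
case/orP => // /[dup] /size_prefix vu; rewrite !prefixE => /eqP uv uv'.
have e : size u = size v by apply/eqP; rewrite eqn_leq vu uv'.
by rewrite e take_size -uv -e take_size.
Qed.

Lemma comparable_prefix u v w :
  comparable u w -> prefix v w -> comparable u v.
Proof.
case/orP => uw vw; first exact: prefixes_comparable uw vw.
by apply/orP; right; exact: prefix_trans vw uw.
Qed.

(** Initial segments of [w] are all comparable with [v], because [w] is; so [u] cannot be one of
    them. *)
Lemma incomparable_above u v w : comparable u w -> comparable v w ->
  ~~ comparable u v -> prefix w u && (size w < size u).
Proof.
move=> /orP[uw|wu] vw uv; first by rewrite comparable_sym (comparable_prefix vw) in uv.
rewrite wu ltnNge; apply: contra uv => su.
rewrite comparable_sym; apply: comparable_prefix vw _.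
by apply: comparable_leq su; rewrite /comparable wu orbT.
Qed.

Lemma sacks_le_refl p : sacks_le p p.
Proof. by []. Qed.

Lemma sacks_le_trans q p r : sacks_le p q -> sacks_le q r -> sacks_le p r.
Proof. exact: subset_trans. Qed.

Arguments sacks_le_trans [q p r] _ _.

Lemma sacks_sub (p : sacks) s t : prefix s t -> sacks_tree p t -> sacks_tree p s.
Proof. by case: (sacks_perfect p) => tp _ _; exact: tp. Qed.

Lemma sacks_split (p : sacks) t : sacks_tree p t -> exists u v,
  [/\ sacks_tree p u, sacks_tree p v, prefix t u, prefix t v & ~~ comparable u v].
Proof.
case: (sacks_perfect p) => _ _ sp /sp[u [v [pu pv [tu tv] [uv vu]]]].
by exists u, v; split=> //; rewrite /comparable negb_or uv vu.
Qed.

Lemma sacks_nil (p : sacks) : sacks_tree p [::].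
Proof. by case: (sacks_perfect p) => tp [t pt] _; exact: tp (prefix0s t) pt. Qed.

(** Any node through which the whole tree passes counts, not just the longest one. *)
Definition has_stem (p : sacks) w := forall u, sacks_tree p u -> comparable u w.

Lemma stem_mem (p : sacks) w : has_stem p w -> sacks_tree p w.
Proof.
move=> st; have [u [v [pu pv _ _ uv]]] := sacks_split (sacks_nil p).
have /andP[wu _] := incomparable_above (st _ pu) (st _ pv) uv.
exact: sacks_sub wu pu.
Qed.

Lemma sacks_restrict (p : sacks) t : sacks_tree p t -> exists q : sacks,
  forall u, sacks_tree q u <-> sacks_tree p u /\ comparable u t.
Proof.
move=> pt; pose T : set (seq bool) := [set u | sacks_tree p u /\ comparable u t].
suff pT : perfect_tree T by exists (Sacks pT).
split.
- move=> u v uv [pv vt]; split; first exact: sacks_sub pv.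
  by rewrite comparable_sym (comparable_prefix _ uv) // comparable_sym.
- by exists [::]; split; [exact: sacks_nil | rewrite /comparable prefix0s].
- move=> u [pu ut].
  (* The longer of [u] and [t] is split: both halves then extend [t] and stay in the restricted
     tree. *)
  have [w [pw uw tw]] : exists w, [/\ sacks_tree p w, prefix u w & prefix t w].
    by case/orP: ut => ?; [exists t | exists u]; split=> //; exact: prefix_refl.
  have [a [b [pa pb wa wb]]] := sacks_split pw; rewrite negb_or => /andP[ab ba].
  exists a, b; split=> //.
  + by split=> //; rewrite /comparable (prefix_trans tw wa) orbT.
  + by split=> //; rewrite /comparable (prefix_trans tw wb) orbT.
  + by split; exact: prefix_trans uw _.
Qed.

Lemma sacks_branching (p : sacks) : exists u : bool -> seq bool * sacks,
  (forall b, sacks_le (u b).2 p /\ has_stem (u b).2 (u b).1) /\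
  ~~ comparable (u false).1 (u true).1.
Proof.
have [u [v [pu pv _ _ uv]]] := sacks_split (sacks_nil p).
have [q0 q0E] := sacks_restrict pu; have [q1 q1E] := sacks_restrict pv.
exists (fun b => if b then (v, q1) else (u, q0)); split=> //.
by case=> /=; split=> w; first [case/q1E | case/q0E].
Qed.

(** Induction on the number of trees. If a node [t] of [r] lies outside the first tree, so do all
    its extensions, and [r] restricted to [t] is covered by the remaining trees. *)
Lemma sacks_cover (qs : seq sacks) (r : sacks) :
  (forall t, sacks_tree r t -> exists2 i, i < size qs & sacks_tree (nth sacks_top qs i) t) ->
  exists i, i < size qs /\
    exists r', sacks_le r' r /\ sacks_le r' (nth sacks_top qs i).
Proof.
elim: qs r => [|q qs IH] r cov; first by have [] := cov _ (sacks_nil r).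
have [rq|/existsNP[t /not_implyP[rt nqt]]] := pselect (sacks_le r q).
  by exists 0; split=> //; exists r; split=> //; exact: sacks_le_refl.
have [r1 r1E] := sacks_restrict rt.
have r1r : sacks_le r1 r by move=> u /r1E[].
have r1cov u : sacks_tree r1 u -> prefix t u ->
    exists2 i, i < size qs & sacks_tree (nth sacks_top qs i) u.
  move=> /r1r ru tu; have [[|i] ilt /= iu] := cov _ ru; last by exists i.
  by case: nqt; exact: sacks_sub iu.
(* Nodes shorter than [t] are covered by any tree that contains [t]. *)
have [u r1u|i [ilt [r' [r'r1 r'i]]]] := IH r1.
  have /r1E[_ /orP[ut|tu]] := r1u; last exact: r1cov.
  have [|i ilt it] := r1cov t _ (prefix_refl _).
    by apply/r1E; rewrite /comparable prefix_refl.
  by exists i => //; exact: sacks_sub it.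
by exists i.+1; split=> //; exists r'; split=> //; exact: sacks_le_trans r1r.
Qed.

(** * Fusion *)

Definition below (P : seq bool -> sacks) (p : sacks) := forall s, sacks_le (P s) p.

(** Only words of length [k] are compared, so such a [D] depends on the conditions at these words
    alone and survives shrinking them. *)
Definition open_at (k : nat) (D : (seq bool -> sacks) -> Prop) :=
  forall P Q, (forall s, size s = k -> sacks_le (Q s) (P s)) -> D P -> D Q.

Definition dense_below (p : sacks) (D : (seq bool -> sacks) -> Prop) :=
  forall P, below P p -> exists2 Q, (forall s, sacks_le (Q s) (P s)) & D Q.

Definition predense_below (k : nat) (q : sacks) (Q : seq bool -> sacks) :=
  forall r, sacks_le r q -> exists s, size s = k /\
    exists r', sacks_le r' r /\ sacks_le r' (Q s).

Lemma mkseq_eq (T : Type) (x y : nat -> T) k :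
  (forall i, i < k -> x i = y i) -> mkseq x k = mkseq y k.
Proof.
by move=> xy; apply/eq_in_map => i; rewrite mem_iota => /andP[_]; exact: xy.
Qed.

Section Fusion.

Variables (split : sacks -> bool -> seq bool * sacks)
  (shrink : nat -> (seq bool -> sacks) -> seq bool -> sacks) (p : sacks).

Hypothesis split_stem : forall p b,
  sacks_le (split p b).2 p /\ has_stem (split p b).2 (split p b).1.
Hypothesis split_incomp : forall p,
  ~~ comparable (split p false).1 (split p true).1.
Hypothesis shrink_le : forall k P s, sacks_le (shrink k P s) (P s).

(** Stage [k] is meant for words of length [k]; the default bit is reached only at shorter words,
    where the value has no meaning. *)
Fixpoint stage (k : nat) : seq bool -> sacks :=
  match k with
  | 0 => shrink 0 (fun=> p)
  | j.+1 => shrink k (fun s => (split (stage j (take j s)) (nth false s j)).2)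
  end.

Definition approx (k : nat) (x : nat -> bool) := stage k (mkseq x k).

(** The stem produced by the last splitting along [x]; later shrinking keeps it as a stem. *)
Definition node (k : nat) (x : nat -> bool) :=
  if k is j.+1 then (split (approx j x) (x j)).1 else [::].

Lemma approxS_split k x : sacks_le (approx k.+1 x) (split (approx k x) (x k)).2.
Proof.
rewrite /approx /=; apply: sacks_le_trans (@shrink_le _ _ _) _ => /=.
rewrite nth_mkseq //; suff -> : take k (mkseq x k.+1) = mkseq x k by [].
rewrite -addn1 /mkseq iotaD map_cat take_cat size_map size_iota ltnn subnn.
by rewrite take0 cats0.
Qed.

Lemma approxS k x : sacks_le (approx k.+1 x) (approx k x).
Proof. exact: sacks_le_trans (@approxS_split k x) (split_stem _ _).1. Qed.

Lemma approx_le j k x : j <= k -> sacks_le (approx k x) (approx j x).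
Proof.
move/subnK <-; elim: (k - j) => [|n IH]; first by rewrite add0n.
by rewrite addSn; exact: sacks_le_trans (@approxS _ _) IH.
Qed.

Lemma approx_stem k x : has_stem (approx k x) (node k x).
Proof.
case: k => [|k] u /=; first by rewrite /comparable prefix0s orbT.
by move/approxS_split; exact: (split_stem _ _).2.
Qed.

Lemma node_approx k x : sacks_tree (approx k x) (node k x).
Proof. exact: stem_mem (@approx_stem k x). Qed.

(** The stems of the two halves are comparable with the old stem but not with each other, so both
    extend it properly. *)
Lemma nodeS k x : prefix (node k x) (node k.+1 x) && (size (node k x) < size (node k.+1 x)).
Proof.
rewrite [node k.+1 x]/=; have st b : comparable (split (approx k x) b).1 (node k x).
  apply: approx_stem; apply: (split_stem (approx k x) b).1.
  exact: stem_mem (split_stem _ _).2.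
have sp := split_incomp (approx k x).
case: (x k).
- by apply: incomparable_above (st true) (st false) _; rewrite comparable_sym.
- exact: incomparable_above (st false) (st true) _.
Qed.

Lemma size_node k x : k <= size (node k x).
Proof.
elim: k => [//|k IH]; have /andP[_ lt] := nodeS k x; exact: leq_ltn_trans IH lt.
Qed.

Lemma node_prefix j k x : j <= k -> prefix (node j x) (node k x).
Proof.
move/subnK <-; elim: (k - j) => [|n IH]; first by rewrite add0n prefix_refl.
by rewrite addSn; have /andP[h _] := nodeS (n + j) x; exact: prefix_trans IH h.
Qed.

Lemma node_mem j k x : sacks_tree (approx j x) (node k x).
Proof.
case/orP: (leq_total j k) => jk; first exact: (@approx_le j k x jk _ (node_approx k x)).
exact: sacks_sub (node_prefix x jk) (node_approx j x).
Qed.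

Lemma approx_eq k x y : (forall i, i < k -> x i = y i) -> approx k x = approx k y.
Proof. by move=> xy; rewrite /approx (mkseq_eq xy). Qed.

(** The witness x may depend on the stage j; no compactness argument is needed. *)
Definition fusion_tree (s : seq bool) : set (seq bool) :=
  [set t | forall j, exists2 x : nat -> bool, mkseq x (size s) = s & sacks_tree (approx j x) t].

(** At a stage beyond the length of [t] the stem is at least as long as [t], so comparability with
    it becomes extension. *)
Lemma fusion_treeP s t k : size s <= k -> fusion_tree s t ->
  exists2 x : nat -> bool, mkseq x (size s) = s & prefix t (node (maxn k (size t)) x).
Proof.
move=> sk /(_ (maxn k (size t)))[x xs tx]; exists x => //.
apply: comparable_leq (approx_stem tx) _.
by apply: leq_trans (size_node _ _); exact: leq_maxr.
Qed.

Lemma fusion_node k x s : mkseq x (size s) = s -> fusion_tree s (node k x).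
Proof. by move=> xs j; exists x => //; exact: node_mem. Qed.

Lemma fusion_perfect s : perfect_tree (fusion_tree s).
Proof.
split.
- move=> u v uv + j => /(_ j)[x xs xv]; exists x => //; exact: sacks_sub xv.
- exists [::] => j; exists (nth false s); last exact: sacks_nil.
  exact: mkseq_nth.
move=> t /(fusion_treeP (leqnn _))[x xs tx]; set k := maxn _ _ in tx.
(* The branch [y b] follows [x] up to stage [k] and then enters half [b]; its next stem lies above
   [t]. *)
pose y b i := if i == k then b else x i.
have yx b i : i < k -> y b i = x i by move=> ik; rewrite /y ltn_eqF.
have ys b : mkseq (y b) (size s) = s.
  rewrite -[RHS]xs; apply: mkseq_eq => i ilt; apply: yx.
  by apply: leq_trans ilt _; exact: leq_maxl.
have ny b : node k.+1 (y b) = (split (approx k x) b).1.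
  by rewrite /= (approx_eq (yx b)) /y eqxx.
have ty b : prefix t (node k.+1 (y b)).
  apply: prefix_trans tx _; have -> : node k x = node k (y b); last exact: node_prefix.
  case: (k) yx => //= j yx; rewrite yx // (@approx_eq j x (y b)) // => i ij.
  by rewrite yx // ltnS ltnW.
have := split_incomp (approx k x); rewrite -!ny negb_or => /andP[n1 n2].
by exists (node k.+1 (y false)), (node k.+1 (y true)); split=> //; exact: fusion_node.
Qed.

Definition fusion s : sacks := Sacks (@fusion_perfect s).

Lemma fusion_le_nil s : sacks_le (fusion s) (fusion [::]).
Proof. by move=> t + j => /(_ j)[x _ xt]; exists x. Qed.

Lemma fusion_le_stage s : sacks_le (fusion s) (stage (size s) s).
Proof. by move=> t /(_ (size s))[x xs]; rewrite /approx xs. Qed.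

(** Every node of the fusion lies under a stem along some branch [x], hence in the tree indexed by
    the first [k] bits of [x]. These finitely many trees therefore cover the fusion, and
    [sacks_cover] applies. *)
Lemma fusion_predense k : predense_below k (fusion [::]) fusion.
Proof.
move=> r rq; pose en := enum {: k.-tuple bool}.
have szE i : i < size en -> size (tval (nth (nseq_tuple k false) en i)) = k.
  by rewrite size_tuple.
pose qs := [seq fusion (tval s) | s <- en].
have [t /rq /(fusion_treeP (leq0n k : size [::] <= k))[x _ tx]|i [ilt [r' [r'r r'i]]]] := @sacks_cover qs r.
  have sz : size (mkseq x k) == k by rewrite size_mkseq.
  exists (index (Tuple sz) en); first by rewrite size_map index_mem mem_enum.
  rewrite (nth_map (nseq_tuple k false)) ?index_mem ?mem_enum // nth_index ?mem_enum //=.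
  by apply: (@sacks_sub (fusion (mkseq x k)) _ _ tx); apply: fusion_node; rewrite size_mkseq.
rewrite size_map in ilt; rewrite (nth_map (nseq_tuple k false)) // in r'i.
exists (tval (nth (nseq_tuple k false) en i)); split; first exact: szE.
by exists r'.
Qed.

End Fusion.

Lemma fusion_lemma (D : nat -> (seq bool -> sacks) -> Prop) (p : sacks) :
  (forall k, open_at k (D k)) -> (forall k, dense_below p (D k)) ->
  exists Q, [/\ sacks_le (Q [::]) p, below Q (Q [::]), forall k, D k Q &
    forall k, predense_below k (Q [::]) Q].
Proof.
move=> Dopen Ddense.
have [split /all_and2[split1 split2]] := choice sacks_branching.
(* Shrinking is made total by leaving families that are not below [p] unchanged. *)
have shrinkable k P : exists Q, (forall s, sacks_le (Q s) (P s)) /\ (below P p -> D k Q).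
  have [/(Ddense k P)[Q QP DQ]|nP] := pselect (below P p); first by exists Q.
  by exists P; split=> [s|//]; exact: sacks_le_refl.
have [shrink0 shrinkP] := choice (fun kP => shrinkable kP.1 kP.2).
pose shrink k P := shrink0 (k, P).
have shrink_le k P s : sacks_le (shrink k P s) (P s) by exact: (shrinkP (k, P)).1.
have shrink_D k P : below P p -> D k (shrink k P) by exact: (shrinkP (k, P)).2.
pose st := stage split shrink p.
have st_D k : below (st k) p /\ D k (st k).
  elim: k => [|k [IHb _]].
    have b0 : below (fun=> p) p by move=> s; exact: sacks_le_refl.
    by split; [move=> s; exact: shrink_le | exact: shrink_D].
  have bk : below (fun s => (split (st k (take k s)) (nth false s k)).2) p.
    by move=> s; apply: sacks_le_trans (split1 _ _).1 _; exact: (IHb (take k s)).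
  split; last exact: shrink_D.
  by move=> s; apply: sacks_le_trans (@shrink_le _ _ _) _; exact: bk.
exists (@fusion split shrink p split1 split2 shrink_le); split.
- apply: sacks_le_trans (@fusion_le_stage _ _ _ _ _ _ _) _; exact: (st_D 0).1.
- exact: fusion_le_nil.
(* Openness carries the requirement met at stage [k] over to the fusion. *)
- move=> k; apply: Dopen (st_D k).2 => s <-; exact: fusion_le_stage.
- exact: fusion_predense.
Qed.

(** * Names of reals and the Sacks property *)

(** [R l m r] is read: the condition r forces the value at l to be m. *)
Record real_below (p : sacks) (R : nat -> nat -> sacks -> Prop) : Prop := RealBelow {
  real_mono : forall l m r r', sacks_le r' r -> R l m r -> R l m r';
  real_fun : forall l m m' r, sacks_le r p -> R l m r -> R l m' r -> m = m';
  real_dec : forall l r, sacks_le r p -> exists r', sacks_le r' r /\ exists m, R l m r' }.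

Definition values (R : nat -> nat -> sacks -> Prop) (p : sacks) (l : nat) : set nat :=
  [set m | exists r, sacks_le r p /\ R l m r].

Lemma real_below_le p q R : sacks_le q p -> real_below p R -> real_below q R.
Proof.
move=> qp [mono func dec]; split=> //.
- by move=> l m m' r rq; apply: func; exact: sacks_le_trans qp.
- by move=> l r rq; apply: dec; exact: sacks_le_trans qp.
Qed.

Lemma real_dec_initial p R L : real_below p R -> exists2 q, sacks_le q p &
  forall l, l < L -> exists m, R l m q.
Proof.
move=> [mono _ dec]; elim: L => [|L [q qp qd]]; first by exists p => //; exact: sacks_le_refl.
have [r [rq [m rm]]] := dec L q qp.
exists r; first exact: sacks_le_trans rq qp.
move=> l; rewrite ltnS leq_eqVlt => /predU1P[->|/qd[n nq]]; first by exists m.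
by exists n; exact: mono nq.
Qed.

Definition words (k : nat) : seq (seq bool) := [seq tval s | s <- enum {: k.-tuple bool}].

Lemma mem_words k s : (s \in words k) = (size s == k).
Proof.
apply/mapP/idP => [[t _ ->]|sk]; first by rewrite size_tuple.
by exists (Tuple sk); rewrite ?mem_enum.
Qed.

Lemma size_words k : size (words k) = 2 ^ k.
Proof. by rewrite size_map -cardE card_tuple card_bool. Qed.

(** A condition that forces a value is compatible with some [Q s] and must agree with its decision,
    so each word of length [k] contributes at most one value. *)
Lemma values_card p q k (Q : seq bool -> sacks) R l : real_below p R ->
  sacks_le q p -> below Q q -> predense_below k q Q ->
  (forall s, size s = k -> exists m, R l m (Q s)) ->
  (values R q l #<= `I_(2 ^ k))%card.
Proof.
move=> Rp qp Qq pre dec.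
have [F FP] : {F : seq bool -> nat & forall s, size s = k -> R l (F s) (Q s)}.
  apply: (@choice _ _ (fun s m => size s = k -> R l m (Q s))) => s.
  have [sk|nsk] := pselect (size s = k); last by exists 0.
  by have [m mP] := dec s sk; exists m.
apply: card_le_trans (card_image_le (fun i => F (nth [::] (words k) i)) _).
apply: subset_card_le => m [r [rq rm]].
have [s [sk [r' [r'r r's]]]] := pre r rq.
have ms : s \in words k by rewrite mem_words sk.
exists (index s (words k)); first by rewrite /= -size_words index_mem.
rewrite /= nth_index //.
exact (real_fun Rp (sacks_le_trans r'r (sacks_le_trans rq qp))
  (real_mono Rp r's (FP s sk)) (real_mono Rp r'r rm)).
Qed.

Lemma sacks_property p R (g : nat -> nat) : real_below p R ->
  (forall l, 0 < g l) -> (forall N, exists L, forall l, L <= l -> N <= g l) ->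
  exists2 q, sacks_le q p & forall l, (values R q l #<= `I_(g l))%card.
Proof.
move=> Rp g_gt0 g_oo.
(* From level [L k] on there is room for the 2^(k+1) conditions of stage k+1; stage [k] has to
   decide only the levels before [L k]. *)
have [L LP] := choice (fun k => g_oo (2 ^ k.+1)).
pose D k (P : seq bool -> sacks) :=
  forall s, size s = k -> forall l, l < L k -> exists m, R l m (P s).
have [k P Q QP DP s sk l lk|k P Pp|Q [Qp Qq DQ pre]] := @fusion_lemma D p.
- have [m mP] := DP s sk l lk; exists m; exact: (real_mono Rp) (QP s sk) mP.
- have [Q QP] : {Q : seq bool -> sacks & forall s,
      sacks_le (Q s) (P s) /\ forall l, l < L k -> exists m, R l m (Q s)}.
    apply: (@choice _ _ (fun s q => sacks_le q (P s) /\
      forall l, l < L k -> exists m, R l m q)) => s.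
    have [q qP qd] := real_dec_initial (L k) (real_below_le (Pp s) Rp).
    by exists q.
  by exists Q => s; [exact: (QP s).1 | move=> _; exact: (QP s).2].
exists (Q [::]) => // l.
(* Otherwise [L (g l) <= l] would give 2^(g l + 1) <= g l. *)
have lL : exists k, l < L k.
  exists (g l); rewrite ltnNge; apply/negP => /LP; rewrite leqNgt.
  by rewrite (ltn_trans (ltnSn _)) // ltn_expl.
have [k lk kmin] := ex_minnP lL.
(* By minimality of [k], level [l] is past the bound of the previous stage; for [k = 0] there is one
   condition, and positivity of [g] suffices. *)
have h : 2 ^ k <= g l.
  case: k kmin {lk} => [|k] kmin; first by rewrite expn0 g_gt0.
  by apply: LP; rewrite leqNgt; apply/negP => /kmin; rewrite ltnn.
apply: card_le_trans (_ : (`I_(2 ^ k) #<= _)%card); last by rewrite card_le_II.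
by apply: (values_card Rp Qp Qq (pre k)) => s sk; exact: DQ lk.
Qed.

(** * Separating names of reals *)

Definition separated (R : nat -> nat -> sacks -> Prop) p (R' : nat -> nat -> sacks -> Prop) p' :=
  exists l, forall r r' m m', sacks_le r p -> sacks_le r' p' ->
    R l m r -> R' l m' r' -> m <> m'.

(** Together with [real_dec] this says that [p] forces the real to equal [x]. *)
Definition decided (R : nat -> nat -> sacks -> Prop) p (x : nat -> nat) :=
  forall l m r, sacks_le r p -> R l m r -> m = x l.

Definition coincide (R R' : nat -> nat -> sacks -> Prop) p :=
  forall l m m' r, sacks_le r p -> R l m r -> R' l m' r -> m = m'.

(** The second alternative expresses that [p] forces the real outside the ground model. *)
Definition settled (R : nat -> nat -> sacks -> Prop) p :=
  (exists x, decided R p x) \/ forall x r, sacks_le r p -> ~ decided R r x.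

Lemma values_le R p q l : sacks_le q p -> values R q l `<=` values R p l.
Proof. by move=> qp m [r [rq rm]]; exists r; split=> //; exact: sacks_le_trans qp. Qed.

Lemma decided_le R p q x : sacks_le q p -> decided R p x -> decided R q x.
Proof. by move=> qp d l m r rq; apply: d; exact: sacks_le_trans qp. Qed.

Lemma coincide_le R R' p q : sacks_le q p -> coincide R R' p -> coincide R R' q.
Proof. by move=> qp c l m m' r rq; apply: c; exact: sacks_le_trans qp. Qed.

Lemma settled_le R p q : sacks_le q p -> settled R p -> settled R q.
Proof.
move=> qp [[x xd]|nd]; first by left; exists x; exact: decided_le xd.
by right=> x r rq; apply: nd; exact: sacks_le_trans qp.
Qed.

Lemma separated_le R R' p p' q q' : sacks_le q p -> sacks_le q' p' ->
  separated R p R' p' -> separated R q R' q'.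
Proof.
move=> qp qp' [l lP]; exists l => r r' m m' rq rq'.
by apply: lP; [exact: sacks_le_trans qp | exact: sacks_le_trans qp'].
Qed.

Lemma decided_inj p R x y : real_below p R -> decided R p x -> decided R p y -> x = y.
Proof.
move=> Rp dx dy; apply: funext => l.
have [r [rp [m rm]]] := real_dec Rp l (@sacks_le_refl p).
by rewrite -(dx _ _ _ rp rm) (dy _ _ _ rp rm).
Qed.

Lemma settled_dense p R : exists2 q, sacks_le q p & settled R q.
Proof.
have [[x [q [qp qx]]]|nd] := pselect (exists x q, sacks_le q p /\ decided R q x).
  by exists q => //; left; exists x.
exists p; first exact: sacks_le_refl.
by right=> x r rp dx; apply: nd; exists x, r.
Qed.

Lemma separated_values p p' R R' l m m' : real_below p R -> real_below p' R' ->
  R l m p -> R' l m' p' -> m <> m' -> separated R p R' p'.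
Proof.
move=> Rp Rp' pm pm' mm'; exists l => r r' n n' rp rp' rn rn'.
rewrite (real_fun Rp rp rn (real_mono Rp rp pm)).
by rewrite (real_fun Rp' rp' rn' (real_mono Rp' rp' pm')).
Qed.

(** The two conditions shrink independently. If no level offers different values to the two sides,
    every level has a single value common to both, and these values form the decided real [x]. *)
Lemma separate p p' R R' : real_below p R -> real_below p' R' ->
  exists q q', [/\ sacks_le q p, sacks_le q' p' &
    separated R q R' q' \/ exists x, decided R q x /\ decided R' q' x].
Proof.
move=> Rp Rp'.
have [[l [m [m' [[r [rp rm]] [[r' [rp' rm']] mm']]]]]|same] :=
  pselect (exists l m m', values R p l m /\ values R' p' l m' /\ m <> m').
  exists r, r'; split=> //; left.
  exact: separated_values (real_below_le rp Rp) (real_below_le rp' Rp') rm rm' mm'.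
have eqv l m m' : values R p l m -> values R' p' l m' -> m = m'.
  by move=> vm vm'; apply: contrapT => mm'; apply: same; exists l, m, m'.
have val l : exists m, values R p l m.
  by have [r [rp [m rm]]] := real_dec Rp l (@sacks_le_refl p); exists m, r.
have val' l : exists m, values R' p' l m.
  by have [r [rp [m rm]]] := real_dec Rp' l (@sacks_le_refl p'); exists m, r.
have [x xP] := choice val.
exists p, p'; split; [exact: sacks_le_refl..|right; exists x].
have dx' : decided R' p' x.
  by move=> l m r rp rm; apply/esym/(eqv _ _ _ (xP l)); exists r.
split=> // l m r rp rm; have [m' vm'] := val' l.
by rewrite (eqv l (x l) m') //; apply: eqv vm'; exists r.
Qed.

(** Under a common condition the two reals cannot be shrunk independently, so failure of separation
    yields only their equality. *)
Lemma separate_or_coincide p R R' : real_below p R -> real_below p R' ->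
  exists2 q, sacks_le q p & separated R q R' q \/ coincide R R' q.
Proof.
move=> Rp Rp'.
have [[l [m [m' [r [rp [rm [rm' mm']]]]]]]|same] :=
  pselect (exists l m m' r, sacks_le r p /\ R l m r /\ R' l m' r /\ m <> m').
  exists r => //; left.
  exact: separated_values (real_below_le rp Rp) (real_below_le rp Rp') rm rm' mm'.
exists p; first exact: sacks_le_refl.
right=> l m m' r rp rm rm'; apply: contrapT => mm'; apply: same.
by exists l, m, m', r.
Qed.

(** * Finitely many requirements at one stage, and the slots *)

Lemma open_forall_in (I : Type) (A : I -> Prop) k (D : I -> (seq bool -> sacks) -> Prop) :
  (forall i, A i -> open_at k (D i)) -> open_at k (fun P => forall i, A i -> D i P).
Proof. by move=> Dopen P Q QP DP i Ai; exact: Dopen QP (DP i Ai). Qed.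

(** The requirements are met one after the other; openness preserves those met earlier. *)
Lemma dense_forall_in (I : eqType) (l : seq I) k p (D : I -> (seq bool -> sacks) -> Prop) :
  (forall i, i \in l -> open_at k (D i)) -> (forall i, i \in l -> dense_below p (D i)) ->
  dense_below p (fun P => forall i, i \in l -> D i P).
Proof.
elim: l => [|i l IH] Dopen Ddense P Pp; first by exists P => // s; exact: sacks_le_refl.
have [|j jl|Q QP DQ] := IH _ _ P Pp.
- by move=> j jl; apply: Dopen; rewrite in_cons jl orbT.
- by apply: Ddense; rewrite in_cons jl orbT.
have [|Q' Q'Q DQ'] := Ddense i (mem_head _ _) Q.
  by move=> s; apply: sacks_le_trans (QP s) _; exact: Pp.
exists Q' => [s|j]; first exact: sacks_le_trans (Q'Q s) (QP s).
rewrite in_cons => /predU1P[->//|jl]; apply: Dopen (DQ j jl); first by rewrite in_cons jl orbT.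
by move=> s _; exact: Q'Q.
Qed.

Definition update (P : seq bool -> sacks) s q : seq bool -> sacks :=
  fun t => if t == s then q else P t.

Lemma update_le P s q t : sacks_le q (P s) -> sacks_le (update P s q t) (P t).
Proof. by rewrite /update; case: eqP => [->|_] // _; exact: sacks_le_refl. Qed.

Lemma update_eq P s q : update P s q s = q.
Proof. by rewrite /update eqxx. Qed.

Lemma update_neq P s q t : t <> s -> update P s q t = P t.
Proof. by rewrite /update => /eqP/negbTE ->. Qed.

Definition slot_pair (R : nat -> nat -> nat -> sacks -> Prop) s n s' n' (P : seq bool -> sacks) :=
  [\/ separated (R n) (P s) (R n') (P s'),
      exists x, decided (R n) (P s) x /\ decided (R n') (P s') x |
      s = s' /\ coincide (R n) (R n') (P s)].

Lemma slot_pair_open R s n s' n' k : size s = k -> size s' = k ->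
  open_at k (slot_pair R s n s' n').
Proof.
move=> sk sk' P Q QP [sep|[x [dx dx']]|[ss' c]].
- by apply: Or31; exact: separated_le (QP s sk) (QP s' sk') sep.
- apply: Or32; exists x.
  by split; [exact: decided_le (QP s sk) dx | exact: decided_le (QP s' sk') dx'].
- by apply: Or33; split=> //; exact: coincide_le (QP s sk) c.
Qed.

Lemma slot_pair_dense p R s n s' n' : (forall n, real_below p (R n)) ->
  dense_below p (slot_pair R s n s' n').
Proof.
move=> Rp P Pp; have RP t m : real_below (P t) (R m) := real_below_le (Pp t) (Rp m).
(* Equal words share one condition; distinct words have conditions that can be replaced
   separately. *)
have [<-|ss'] := pselect (s = s').
  have [q qp h] := separate_or_coincide (RP s n) (RP s n').
  exists (update P s q) => [t|]; first exact: update_le.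
  rewrite /slot_pair update_eq.
  by case: h => ?; [apply: Or31 | apply: Or33].
have [q [q' [qp qp' h]]] := separate (RP s n) (RP s' n').
exists (update (update P s q) s' q') => [t|].
  have qP' : sacks_le q' (update P s q s') by rewrite update_neq // => /esym.
  exact: sacks_le_trans (@update_le _ _ _ t qP') (@update_le _ _ _ t qp).
rewrite /slot_pair update_eq update_neq // update_eq.
by case: h => ?; [apply: Or31 | apply: Or32].
Qed.

Definition slot (R : nat -> nat -> nat -> sacks -> Prop) (g : nat -> nat) s n
    (P : seq bool -> sacks) :=
  (forall l, (values (R n) (P s) l #<= `I_(g l))%card) /\ settled (R n) (P s).

Lemma slot_open R g s n : open_at (size s) (slot R g s n).
Proof.
move=> P Q QP [v st]; split=> [l|]; last exact: settled_le (QP s erefl) st.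
by apply: card_le_trans (v l); apply: subset_card_le; exact: values_le (QP s erefl).
Qed.

Lemma slot_dense p R g s n : real_below p (R n) -> (forall l, 0 < g l) ->
  (forall N, exists L, forall l, L <= l -> N <= g l) -> dense_below p (slot R g s n).
Proof.
move=> Rp g_gt0 g_oo P Pp.
have [q qP qv] := sacks_property (real_below_le (Pp s) Rp) g_gt0 g_oo.
have [r rq rs] := settled_dense q (R n).
exists (update P s r) => [t|]; first by apply: update_le; exact: sacks_le_trans qP.
split=> [l|]; rewrite update_eq //.
by apply: card_le_trans (qv l); apply: subset_card_le; exact: values_le.
Qed.

Lemma slots_fusion p (R : nat -> nat -> nat -> sacks -> Prop) (eta : nat -> {fset nat})
    (g : seq bool -> nat -> nat -> nat) :
  (forall n, real_below p (R n)) -> (forall s n l, 0 < g s n l) ->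
  (forall s n N, exists L, forall l, L <= l -> N <= g s n l) ->
  exists Q, [/\ sacks_le (Q [::]) p, below Q (Q [::]),
    forall k, predense_below k (Q [::]) Q,
    forall s n, n \in eta (size s) -> slot R (g s n) s n Q &
    forall s n s' n', size s = size s' -> n \in eta (size s) -> n' \in eta (size s) ->
      slot_pair R s n s' n' Q].
Proof.
move=> Rp g_gt0 g_oo.
pose D1 k P := forall s, s \in words k -> forall n, n \in enum_fset (eta k) -> slot R (g s n) s n P.
pose D2 k P := forall s, s \in words k -> forall n, n \in enum_fset (eta k) ->
  forall s', s' \in words k -> forall n', n' \in enum_fset (eta k) -> slot_pair R s n s' n' P.
(* Indexing by a boolean merges the two kinds of requirement into one finite conjunction. *)
pose D k P := forall b : bool, b \in [:: true; false] -> if b then D1 k P else D2 k P.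
have D1_open k : open_at k (D1 k).
  apply: open_forall_in => s; rewrite mem_words => /eqP <-.
  by apply: open_forall_in => n _; exact: slot_open.
have D2_open k : open_at k (D2 k).
  apply: open_forall_in => s; rewrite mem_words => /eqP sk.
  apply: open_forall_in => n _; apply: open_forall_in => s'; rewrite mem_words => /eqP sk'.
  by apply: open_forall_in => n' _; exact: slot_pair_open.
have [k|k|Q [Qp Qq DQ pre]] := @fusion_lemma D p.
- by apply: open_forall_in => -[].
- apply: (@dense_forall_in _ _ k) => -[] _ //.
  + apply: (@dense_forall_in _ _ k) => s; rewrite mem_words => /eqP <-.
      by apply: open_forall_in => n _; exact: slot_open.
    apply: (@dense_forall_in _ _ (size s)) => n _; first exact: slot_open.
    by apply: slot_dense.
  + apply: (@dense_forall_in _ _ k) => s; rewrite mem_words => /eqP sk.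
      apply: open_forall_in => n _; apply: open_forall_in => s'; rewrite mem_words => /eqP sk'.
      by apply: open_forall_in => n' _; exact: slot_pair_open.
    apply: (@dense_forall_in _ _ k) => n _.
      apply: open_forall_in => s'; rewrite mem_words => /eqP sk'.
      by apply: open_forall_in => n' _; exact: slot_pair_open.
    apply: (@dense_forall_in _ _ k) => s'; rewrite mem_words => /eqP sk'.
      by apply: open_forall_in => n' _; exact: slot_pair_open.
    apply: (@dense_forall_in _ _ k) => n' _; first exact: slot_pair_open.
    exact: slot_pair_dense.
exists Q; split=> //.
- move=> s n ns; apply: (DQ (size s) true) => //; by rewrite mem_words.
- move=> s n s' n' ss' ns ns'.
  by apply: (DQ (size s) false) => //; rewrite mem_words // ss'.
Qed.

(** * The forcing relation *)

(** A [formula] is an arbitrary predicate on conditions; persistence and [dense_closed] are the two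
    laws of a forcing relation, proved for each connective. *)
Definition persistent (phi : formula) := forall p q, sacks_le q p -> phi p -> phi q.

Definition dense_closed (phi : formula) :=
  forall p, (forall q, sacks_le q p -> exists2 r, sacks_le r q & phi r) -> phi p.

Lemma generic_persistent s : persistent (f_generic s).
Proof. by move=> p q qp; exact: sacks_le_trans. Qed.

Lemma imp_persistent phi psi : persistent (f_imp phi psi).
Proof. by move=> p q qp h r rq; apply: h; exact: sacks_le_trans qp. Qed.

Lemma ex_persistent A (phi : A -> formula) : persistent (f_ex phi).
Proof. by move=> p q qp h r rq; apply: h; exact: sacks_le_trans qp. Qed.

Lemma or_persistent phi psi : persistent (f_or phi psi).
Proof. by move=> p q qp h r rq; apply: h; exact: sacks_le_trans qp. Qed.

Lemma and_persistent phi psi : persistent phi -> persistent psi -> persistent (f_and phi psi).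
Proof. by move=> h1 h2 p q qp [/(h1 _ _ qp) ? /(h2 _ _ qp)]. Qed.

Lemma all_persistent A (phi : A -> formula) :
  (forall a, persistent (phi a)) -> persistent (f_all phi).
Proof. by move=> h p q qp H a; exact: h qp (H a). Qed.

Lemma ex_dense_closed A (phi : A -> formula) : dense_closed (f_ex phi).
Proof.
move=> p h q qp; have [r rq /(_ r (@sacks_le_refl r))[r' [r'r H]]] := h q qp.
by exists r'; split=> //; exact: sacks_le_trans rq.
Qed.

Lemma imp_dense_closed phi psi :
  persistent phi -> dense_closed psi -> dense_closed (f_imp phi psi).
Proof.
move=> mphi cpsi p h q qp phiq; apply: cpsi => q' q'q.
have [r rq' H] := h q' (sacks_le_trans q'q qp); exists r => //.
by apply: H (@sacks_le_refl r) _; exact: mphi (sacks_le_trans rq' q'q) phiq.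
Qed.

Lemma all_dense_closed A (phi : A -> formula) :
  (forall a, dense_closed (phi a)) -> dense_closed (f_all phi).
Proof.
by move=> h p H a; apply: h => q /H[r rq Hr]; exists r => //; exact: Hr.
Qed.

Lemma and_dense_closed phi psi :
  dense_closed phi -> dense_closed psi -> dense_closed (f_and phi psi).
Proof.
by move=> h1 h2 p H; split; [apply: h1 | apply: h2] => q /H[r rq [? ?]]; exists r.
Qed.

Lemma ex_intro_forced A (phi : A -> formula) a p :
  (forall q, sacks_le q p -> phi a q) -> f_ex phi p.
Proof. by move=> h q qp; exists q; split; [exact: sacks_le_refl | exists a; exact: h]. Qed.

Lemma or_introl_forced phi psi p : (forall q, sacks_le q p -> phi q) -> f_or phi psi p.
Proof. by move=> h q qp; exists q; split; [exact: sacks_le_refl | left; exact: h]. Qed.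

Lemma or_intror_forced phi psi p : (forall q, sacks_le q p -> psi q) -> f_or phi psi p.
Proof. by move=> h q qp; exists q; split; [exact: sacks_le_refl | right; exact: h]. Qed.

(** Witnesses exist only densely below [p]; a conclusion closed under density can be brought back to
    [p] itself. *)
Lemma ex_elim A (phi : A -> formula) psi p : dense_closed psi -> f_ex phi p ->
  (forall q a, sacks_le q p -> phi a q -> psi q) -> psi p.
Proof.
move=> cpsi h H; apply: cpsi => q qp; have [r [rq [a phir]]] := h q qp.
by exists r => //; apply: H phir; exact: sacks_le_trans qp.
Qed.

Lemma or_elim phi1 phi2 psi p : dense_closed psi -> f_or phi1 phi2 p ->
  (forall q, sacks_le q p -> phi1 q -> psi q) ->
  (forall q, sacks_le q p -> phi2 q -> psi q) -> psi p.
Proof.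
move=> cpsi h H1 H2; apply: cpsi => q qp; have [r [rq phir]] := h q qp.
by exists r => //; case: phir; [apply: H1 | apply: H2]; exact: sacks_le_trans qp.
Qed.

(** * Forced equality and membership *)

Lemma eq_persistent a b : persistent (f_eq a b).
Proof.
case: a b => A x s [B y t]; apply: and_persistent; apply: all_persistent => ?;
  exact: imp_persistent.
Qed.

Lemma eq_dense_closed a b : dense_closed (f_eq a b).
Proof.
case: a b => A x s [B y t]; apply: and_dense_closed; apply: all_dense_closed => ?;
  (apply: imp_dense_closed; [exact: generic_persistent | exact: ex_dense_closed]).
Qed.

Lemma mem_persistent a b : persistent (f_mem a b).
Proof. by case: b => B y t; exact: ex_persistent. Qed.

Lemma mem_dense_closed a b : dense_closed (f_mem a b).
Proof. by case: b => B y t; exact: ex_dense_closed. Qed.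

Lemma eq_refl_forced a p : f_eq a a p.
Proof.
elim: a p => A x IH s p; split=> i q qp si; apply: (@ex_intro_forced _ _ i) => r rq;
  by split; [exact: generic_persistent rq si | exact: IH].
Qed.

Lemma eq_sym_forced a b p : f_eq a b p -> f_eq b a p.
Proof.
elim: a b p => A x IH s [B y t] p [h1 h2]; split=> i q qp g r rq.
- have [r' [r'r [j [gj e]]]] := h2 i q qp g r rq.
  by exists r'; split=> //; exists j; split=> //; exact: IH.
- have [r' [r'r [j [gj e]]]] := h1 i q qp g r rq.
  by exists r'; split=> //; exists j; split=> //; exact: IH.
Qed.

Lemma eq_trans_forced a b c p : f_eq a b p -> f_eq b c p -> f_eq a c p.
Proof.
elim: a b c p => A x IH s [B y t] [C z u] p [ab ba] [bc cb]; split=> i q qp g r rq.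
- have [r1 [r1r [j [gj e]]]] := ab i q qp g r rq.
  have r1p := sacks_le_trans r1r (sacks_le_trans rq qp).
  have [r2 [r2r1 [k [gk e']]]] := bc j r1 r1p gj r1 (@sacks_le_refl r1).
  exists r2; split; first exact: sacks_le_trans r1r.
  exists k; split=> //; apply: IH e'; exact: eq_persistent r2r1 e.
- have [r1 [r1r [j [gj e]]]] := cb i q qp g r rq.
  have r1p := sacks_le_trans r1r (sacks_le_trans rq qp).
  have [r2 [r2r1 [k [gk e']]]] := ba j r1 r1p gj r1 (@sacks_le_refl r1).
  exists r2; split; first exact: sacks_le_trans r1r.
  exists k; split=> //; apply: IH e' _; exact: eq_persistent r2r1 e.
Qed.

Lemma mem_eql a a' b p : f_eq a a' p -> f_mem a b p -> f_mem a' b p.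
Proof.
case: b => B y t aa' h q qp; have [r [rq [j [gj e]]]] := h q qp.
exists r; split=> //; exists j; split=> //.
by apply: eq_trans_forced e; apply/eq_sym_forced/eq_persistent/aa'; exact: sacks_le_trans qp.
Qed.

Lemma mem_eqr a b b' p : f_eq b b' p -> f_mem a b p -> f_mem a b' p.
Proof.
case: b b' => B y t [B' y' t'] [bb' _] h q qp.
have [r [rq [j [gj e]]]] := h q qp.
have [r1 [r1r [k [gk e']]]] := bb' j r (sacks_le_trans rq qp) gj r (@sacks_le_refl r).
exists r1; split; first exact: sacks_le_trans rq.
by exists k; split=> //; apply: eq_trans_forced e'; exact: eq_persistent r1r e.
Qed.

Lemma eq_ext_forced a b p :
  (forall z q, sacks_le q p -> f_mem z a q -> f_mem z b q) ->
  (forall z q, sacks_le q p -> f_mem z b q -> f_mem z a q) -> f_eq a b p.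
Proof.
case: a b => A x s [B y t] ab ba; split=> i q qp g.
- apply: ab qp _; apply: (@ex_intro_forced _ _ i) => r rq.
  by split; [exact: generic_persistent rq g | exact: eq_refl_forced].
- have : f_mem (y i) (Name x s) q.
    apply: ba qp _; apply: (@ex_intro_forced _ _ i) => r rq.
    by split; [exact: generic_persistent rq g | exact: eq_refl_forced].
  move=> h r rq; have [r1 [r1r [j [gj e]]]] := h r rq.
  by exists r1; split=> //; exists j; split=> //; exact: eq_sym_forced.
Qed.

(** * Unordered and ordered pairs *)

Lemma mem_name_of A (elt : A -> name) i p : f_mem (elt i) (name_of elt) p.
Proof. by apply: (@ex_intro_forced _ _ i) => r rp; split=> //; exact: eq_refl_forced. Qed.

Lemma mem_upairl a b p : f_mem a (upair a b) p.
Proof. exact: (@mem_name_of _ (fun c : bool => if c then a else b) true). Qed.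

Lemma mem_upairr a b p : f_mem b (upair a b) p.
Proof. exact: (@mem_name_of _ (fun c : bool => if c then a else b) false). Qed.

Lemma mem_upair z a b p : f_mem z (upair a b) p -> f_or (f_eq z a) (f_eq z b) p.
Proof.
move=> h q qp; have [r [rq [c [_ e]]]] := h q qp.
by exists r; split=> //; case: c e; [left | right].
Qed.

Lemma upair_eq_singleton a c d p : f_eq (upair a a) (upair c d) p -> f_eq c a p /\ f_eq d a p.
Proof.
move=> /eq_sym_forced e.
have in_aa z : f_mem z (upair c d) p -> f_eq z a p.
  move=> /(mem_eqr e)/mem_upair h.
  by apply: (or_elim (@eq_dense_closed _ _) h) => q _.
by split; apply: in_aa; [exact: mem_upairl | exact: mem_upairr].
Qed.

Lemma upair_congr a b a' b' p : f_eq a a' p -> f_eq b b' p -> f_eq (upair a b) (upair a' b') p.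
Proof.
move=> aa' bb'; split=> c q qp _; apply: (@ex_intro_forced _ _ c) => r rq; split=> //;
  have rp := sacks_le_trans rq qp;
  by case: c; [exact: eq_persistent rp aa' | exact: eq_persistent rp bb'].
Qed.

Lemma opair_congr a b a' b' p : f_eq a a' p -> f_eq b b' p -> f_eq (opair a b) (opair a' b') p.
Proof. by move=> ? ?; apply: upair_congr; exact: upair_congr. Qed.

(** Kuratowski's argument carried out below [p]. Each case distinction is forced only densely, so it
    goes through [or_elim]. *)
Lemma opair_inj a b c d p : f_eq (opair a b) (opair c d) p -> f_eq a c p /\ f_eq b d p.
Proof.
move=> e.
have ac : f_eq a c p.
  have := mem_eqr e (@mem_upairl (upair a a) (upair a b) p).
  move=> /mem_upair h; apply: (or_elim (@eq_dense_closed _ _) h) => q qp;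
    by move=> /upair_eq_singleton[/eq_sym_forced].
split=> //.
have abRHS := mem_upair (mem_eqr e (@mem_upairr (upair a a) (upair a b) p)).
have cdLHS := mem_upair (mem_eqr (eq_sym_forced e) (@mem_upairr (upair c c) (upair c d) p)).
(* Either {a,b} = {c,c}, where [b] equals [a] and [c] and it remains to find [d], or {a,b} =
   {c,d}. *)
apply: (or_elim (@eq_dense_closed _ _) abRHS) => q qp ab.
- have [ac1 bc] := upair_eq_singleton (eq_sym_forced ab).
  have bd_of_da r : sacks_le r q -> f_eq d a r -> f_eq b d r.
    move=> rq da; apply: eq_trans_forced (eq_persistent rq bc) _.
    exact: eq_trans_forced (eq_sym_forced (eq_persistent rq ac1)) (eq_sym_forced da).
  apply: (or_elim (@eq_dense_closed _ _) (or_persistent qp cdLHS)) => r rq cd.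
    by have [_ da] := upair_eq_singleton (eq_sym_forced cd); exact: bd_of_da.
  have h := mem_upair (mem_eqr cd (@mem_upairr c d r)).
  apply: (or_elim (@eq_dense_closed _ _) h) => r' r'r; last exact: eq_sym_forced.
  by apply: bd_of_da; exact: sacks_le_trans rq.
- have h := mem_upair (mem_eqr ab (@mem_upairr a b q)).
  apply: (or_elim (@eq_dense_closed _ _) h) => // r rq bc.
  have h' := mem_upair (mem_eqr (eq_sym_forced (eq_persistent rq ab)) (@mem_upairr c d r)).
  apply: (or_elim (@eq_dense_closed _ _) h') => r' r'r; last exact: eq_sym_forced.
  move=> da; apply: eq_trans_forced (eq_persistent r'r bc) _.
  apply: eq_trans_forced _ (eq_sym_forced da); apply: eq_sym_forced.
  exact: eq_persistent (sacks_le_trans r'r (sacks_le_trans rq qp)) ac.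
Qed.

(** * Names of natural numbers and of reals *)

Lemma mem_nat_checkS z n p : f_mem z (nat_check n.+1) p <->
  f_or (f_mem z (nat_check n)) (f_eq z (nat_check n)) p.
Proof.
rewrite [nat_check n.+1]/=; case: (nat_check n) => A x s; split=> h q qp.
- have [r [rq [[i|] [gi e]]]] := h q qp; exists r; split=> //; last by right.
  left; apply: (@ex_intro_forced _ _ i) => r' r'r.
  by split; [exact: generic_persistent r'r gi | exact: eq_persistent r'r e].
- have [r [rq [h'|e]]] := h q qp.
  + have [r1 [r1r [i [gi e]]]] := h' r (@sacks_le_refl r).
    exists r1; split; first exact: sacks_le_trans rq.
    by exists (Some i).
  + by exists r; split=> //; exists None.
Qed.

Lemma mem_nat_check z n p : f_mem z (nat_check n) p ->
  f_ex (fun k => f_and (f_ground (k < n)) (f_eq z (nat_check k))) p.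
Proof.
elim: n p => [|n IH] p; first by move=> h q qp; have [r [rq [[]]]] := h q qp.
move=> /mem_nat_checkS h; apply: (or_elim (@ex_dense_closed _ _) h) => q qp.
- move=> /IH h' r rq; have [r' [r'r [k [kn e]]]] := h' r rq.
  by exists r'; split=> //; exists k; split=> //; exact: ltnW.
- move=> e; apply: (@ex_intro_forced _ _ n) => r rq; split; first exact: ltnSn.
  exact: eq_persistent rq e.
Qed.

Lemma nat_check_mem k n p : k < n -> f_mem (nat_check k) (nat_check n) p.
Proof.
elim: n => // n IH; rewrite ltnS leq_eqVlt => kn; apply/mem_nat_checkS.
case/predU1P: kn => [->|kn]; first by apply: or_intror_forced => q _; exact: eq_refl_forced.
by apply: or_introl_forced => q qp; apply: mem_persistent qp _; exact: IH.
Qed.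

(** Infinite descent: equality would put [k] into itself, so a stronger condition would equate [k]
    with some smaller numeral. *)
Lemma nat_check_neq k n p : k < n -> ~ f_eq (nat_check n) (nat_check k) p.
Proof.
elim/ltn_ind: n k p => n IH k p kn e.
have := mem_eqr e (@nat_check_mem k n p kn).
move=> /mem_nat_check/(_ p (@sacks_le_refl p))[r [rp [j [jk e']]]].
exact: IH kn _ _ jk e'.
Qed.

Lemma nat_check_inj m n p : f_eq (nat_check m) (nat_check n) p -> m = n.
Proof.
by move=> e; case: (ltngtP m n) => // [/nat_check_neq|/nat_check_neq] /(_ p)[] //;
  exact: eq_sym_forced.
Qed.

Lemma mem_omega a p : f_mem a omega p -> f_ex (fun k => f_eq a (nat_check k)) p.
Proof.
by move=> h q qp; have [r [rq [k [_ e]]]] := h q qp; exists r; split=> //; exists k.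
Qed.

Lemma nat_check_omega k p : f_mem (nat_check k) omega p.
Proof. exact: mem_name_of. Qed.

Lemma is_function_persistent g A B : persistent (is_function g A B).
Proof.
apply: and_persistent; last apply: and_persistent.
- by apply: all_persistent => z; exact: imp_persistent.
- by apply: all_persistent => a; exact: imp_persistent.
- apply: all_persistent => a; apply: all_persistent => b; apply: all_persistent => c.
  exact: imp_persistent.
Qed.

Lemma is_function_dense_closed g A B : dense_closed (is_function g A B).
Proof.
apply: and_dense_closed; last apply: and_dense_closed.
- apply: all_dense_closed => z; apply: imp_dense_closed; first exact: mem_persistent.
  exact: ex_dense_closed.
- apply: all_dense_closed => a; apply: imp_dense_closed; first exact: mem_persistent.
  exact: ex_dense_closed.
- apply: all_dense_closed => a; apply: all_dense_closed => b; apply: all_dense_closed => c.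
  apply: imp_dense_closed; first exact: mem_persistent.
  apply: imp_dense_closed; first exact: mem_persistent.
  exact: eq_dense_closed.
Qed.

Lemma is_function_eql g g' A B p : f_eq g g' p -> is_function g A B p -> is_function g' A B p.
Proof.
move=> e [h1 [h2 h3]].
have back z q : sacks_le q p -> f_mem z g' q -> f_mem z g q.
  by move=> qp; apply: mem_eqr; apply: eq_sym_forced; exact: eq_persistent qp e.
split; [|split].
- by move=> z q qp /(back _ _ qp); exact: h1.
- move=> a q qp am r rq; have [r' [r'r [b bm]]] := h2 a q qp am r rq.
  exists r'; split=> //; exists b; apply: mem_eqr bm; apply: eq_persistent e.
  exact: sacks_le_trans r'r (sacks_le_trans rq qp).
- move=> a b c q qp ab r rq ac.
  apply: (h3 a b c q qp (back _ _ qp ab) r rq).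
  exact: back (sacks_le_trans rq qp) ac.
Qed.

Lemma real_value x p i : is_real x p ->
  f_ex (fun m => f_mem (opair (nat_check i) (nat_check m)) x) p.
Proof.
move=> /[dup] xr [h1 [h2 _]] q qp.
have [r [rq [b bm]]] := h2 _ q qp (@nat_check_omega i q) q (@sacks_le_refl q).
have rp := sacks_le_trans rq qp.
have [r1 [r1r [a h]]] := h1 _ r rp bm r (@sacks_le_refl r).
have [r2 [r2r1 [b' [_ [b'o e]]]]] := h r1 (@sacks_le_refl r1).
have [r3 [r3r2 [m e']]] := mem_omega b'o (@sacks_le_refl r2).
have r3r : sacks_le r3 r := sacks_le_trans r3r2 (sacks_le_trans r2r1 r1r).
exists r3; split; first exact: sacks_le_trans rq.
exists m; apply: mem_eql (mem_persistent r3r bm).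
apply: opair_congr; first exact: eq_refl_forced.
exact: eq_trans_forced (eq_persistent r3r2 (opair_inj e).2) e'.
Qed.

Lemma real_value_inj x p i m m' : is_real x p ->
  f_mem (opair (nat_check i) (nat_check m)) x p ->
  f_mem (opair (nat_check i) (nat_check m')) x p -> m = m'.
Proof.
move=> [_ [_ h3]] h h'.
exact: nat_check_inj (h3 _ _ _ p (@sacks_le_refl p) h p (@sacks_le_refl p) h').
Qed.

Lemma real_elements x z p : is_real x p -> f_mem z x p ->
  f_ex (fun i => f_ex (fun m => f_eq z (opair (nat_check i) (nat_check m)))) p.
Proof.
move=> [h1 _] /(h1 _ p (@sacks_le_refl p)) h q qp.
have [r [rq [a h']]] := h q qp.
have [r1 [r1r [b [ao [bo e]]]]] := h' r (@sacks_le_refl r).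
have [r2 [r2r1 [i ei]]] := mem_omega ao (@sacks_le_refl r1).
have [r3 [r3r2 [m em]]] := mem_omega (mem_persistent r2r1 bo) (@sacks_le_refl r2).
have r31 := sacks_le_trans r3r2 r2r1.
exists r3; split; first exact: sacks_le_trans r31 (sacks_le_trans r1r rq).
exists i; apply: (@ex_intro_forced _ _ m) => r' r'r3.
apply: eq_trans_forced (eq_persistent (sacks_le_trans r'r3 r31) e) _.
apply: opair_congr; last exact: eq_persistent r'r3 em.
exact: eq_persistent (sacks_le_trans r'r3 r3r2) ei.
Qed.

(** An element of [x] is a pair of numerals, and as [x] is a function its second coordinate is the
    value shared with [y]. *)
Lemma real_mem_of_values x y p : is_real x p -> is_real y p ->
  (forall i q, sacks_le q p -> exists2 r, sacks_le r q & exists m,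
    f_mem (opair (nat_check i) (nat_check m)) x r /\
    f_mem (opair (nat_check i) (nat_check m)) y r) ->
  forall z q, sacks_le q p -> f_mem z x q -> f_mem z y q.
Proof.
move=> xr yr xy z q qp zx; apply: mem_dense_closed => q' q'q.
have xq' := is_function_persistent (sacks_le_trans q'q qp) xr.
have [r [rq' [i h]]] := real_elements xq' (mem_persistent q'q zx) (@sacks_le_refl q').
have [r1 [r1r [m e]]] := h r (@sacks_le_refl r).
have r1q' := sacks_le_trans r1r rq'.
have r1q := sacks_le_trans r1q' q'q; have r1p := sacks_le_trans r1q qp.
have [r2 r2r1 [m' [xm ym]]] := xy i r1 r1p.
exists r2; first exact: sacks_le_trans r1q'.
have xr2 := is_function_persistent (sacks_le_trans r2r1 r1p) xr.
have e2 := eq_persistent r2r1 e.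
have mm' : m = m'.
  by apply: real_value_inj xr2 _ xm; apply: mem_eql e2 (mem_persistent (sacks_le_trans r2r1 r1q) zx).
by apply: mem_eql (eq_sym_forced e2) _; rewrite mm'.
Qed.

Lemma real_eq x y p : is_real x p -> is_real y p ->
  (forall i q, sacks_le q p -> exists2 r, sacks_le r q & exists m,
    f_mem (opair (nat_check i) (nat_check m)) x r /\
    f_mem (opair (nat_check i) (nat_check m)) y r) -> f_eq x y p.
Proof.
move=> xr yr xy; apply: eq_ext_forced; apply: real_mem_of_values => // i q /xy H.
by have [r rq [m [? ?]]] := H i; exists r => //; exists m.
Qed.

Lemma real_check_value x i p :
  f_mem (opair (nat_check i) (nat_check (x i))) (real_check x) p.
Proof. exact: (@mem_name_of _ (fun k => opair (nat_check k) (nat_check (x k)))). Qed.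

Lemma mem_real_check x z p : f_mem z (real_check x) p ->
  f_ex (fun i => f_eq z (opair (nat_check i) (nat_check (x i)))) p.
Proof.
by move=> h q qp; have [r [rq [k [_ e]]]] := h q qp; exists r; split=> //; exists k.
Qed.

Lemma real_check_real x p : is_real (real_check x) p.
Proof.
split; [|split].
- move=> z q qp /mem_real_check h r rq; have [r1 [r1r [i e]]] := h r rq.
  exists r1; split=> //; exists (nat_check i).
  apply: (@ex_intro_forced _ _ (nat_check (x i))) => r2 r2r1.
  by split; [|split]; [exact: nat_check_omega..|exact: eq_persistent r2r1 e].
- move=> a q qp /mem_omega h r rq; have [r1 [r1r [i e]]] := h r rq.
  exists r1; split=> //; exists (nat_check (x i)).
  apply: mem_eql (@real_check_value x i r1); apply: opair_congr (eq_refl_forced _ _).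
  exact: eq_sym_forced.
- move=> a b c q qp /mem_real_check ab r rq /mem_real_check ac.
  apply: (ex_elim (@eq_dense_closed _ _) (ex_persistent rq ab)) => r1 i r1r /opair_inj[ai bi].
  apply: (ex_elim (@eq_dense_closed _ _) (ex_persistent r1r ac)) => r2 j r2r1 /opair_inj[aj cj].
  have ij : i = j.
    apply: (@nat_check_inj _ _ r2); apply: eq_trans_forced aj.
    by apply: eq_sym_forced; exact: eq_persistent r2r1 ai.
  apply: eq_trans_forced (eq_persistent r2r1 bi) _; rewrite ij; exact: eq_sym_forced.
Qed.

(** * The values of a sequence of reals *)

(** Quantifying over all names for the n-th real avoids choosing one and makes persistence
    immediate. *)
Definition value_at (tau : name) (n l m : nat) : formula :=
  f_all (fun x : name => f_imp (is_value tau n x)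
    (f_mem (opair (nat_check l) (nat_check m)) x)).

Lemma sequence_value tau n p : is_real_sequence tau p -> f_ex (is_value tau n) p.
Proof. by move=> [_ [h _]]; exact: h _ p (@sacks_le_refl p) (@nat_check_omega n p). Qed.

Lemma sequence_value_real tau n x p : is_real_sequence tau p -> is_value tau n x p -> is_real x p.
Proof.
move=> [h1 _] /(h1 _ p (@sacks_le_refl p)) h; apply: is_function_dense_closed => q qp.
have [r [rq [a h']]] := h q qp.
have [r1 [r1r [b [_ [br /opair_inj[_ e]]]]]] := h' r (@sacks_le_refl r).
exists r1; first exact: sacks_le_trans rq.
exact: is_function_eql (eq_sym_forced e) br.
Qed.

Lemma sequence_value_inj tau n x y p : is_real_sequence tau p ->
  is_value tau n x p -> is_value tau n y p -> f_eq x y p.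
Proof.
by move=> [_ [_ h]] hx hy; exact: (h _ _ _ p (@sacks_le_refl p) hx p (@sacks_le_refl p) hy).
Qed.

Lemma value_atI tau n l m x p : is_real_sequence tau p -> is_value tau n x p ->
  f_mem (opair (nat_check l) (nat_check m)) x p -> value_at tau n l m p.
Proof.
move=> tr xv xm y q qp yv; apply: mem_eqr (mem_persistent qp xm).
by apply: (sequence_value_inj (is_function_persistent qp tr)) yv; exact: mem_persistent qp xv.
Qed.

(** This is the bridge from names to the abstract reals for which the fusion is carried out. *)
Lemma value_at_real tau n p : is_real_sequence tau p -> real_below p (value_at tau n).
Proof.
move=> tr; split.
- by move=> l m r r'; apply: all_persistent => x; exact: imp_persistent.
- move=> l m m' r rp hm hm'; have tr' := is_function_persistent rp tr.
  have [q [qr [x xv]]] := sequence_value n tr' (@sacks_le_refl r).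
  have xr := sequence_value_real (is_function_persistent qr tr') xv.
  exact: real_value_inj xr (hm x q qr xv) (hm' x q qr xv).
- move=> l r rp; have tr' := is_function_persistent rp tr.
  have [q [qr [x xv]]] := sequence_value n tr' (@sacks_le_refl r).
  have trq := is_function_persistent qr tr'.
  have [q' [q'q [m xm]]] := real_value l (sequence_value_real trq xv) (@sacks_le_refl q).
  exists q'; split; first exact: sacks_le_trans qr.
  exists m; apply: value_atI (is_function_persistent q'q trq) _ xm.
  exact: mem_persistent q'q xv.
Qed.

(** * Trees of possibilities *)

(** One condition has to force all entries of [t] together; entries that are possible separately do
    not suffice. *)
Definition possibilities (R : nat -> nat -> sacks -> Prop) (p : sacks) : set (seq nat) :=
  [set t | exists r, sacks_le r p /\ forall i, i < size t -> R i (nth 0 t i) r].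

Lemma possibilities_tree R p : is_tree (possibilities R p).
Proof.
move=> s t /prefixP[u ->] [r [rp H]]; exists r; split=> // i ilt.
by have := H i; rewrite size_cat nth_cat ilt; apply; rewrite ltn_addr.
Qed.

Lemma possibilities_leafless R p : real_below p R -> leafless (possibilities R p).
Proof.
move=> Rp t [r [rp H]]; have [q [qr [m qm]]] := real_dec Rp (size t) rp.
exists m, q; split; first exact: sacks_le_trans rp.
move=> i; rewrite size_rcons ltnS nth_rcons leq_eqVlt => /predU1P[->|ilt].
  by rewrite ltnn eqxx.
by rewrite ilt; exact: real_mono Rp _ _ _ _ qr (H i ilt).
Qed.

Lemma possibilities_obeys R p g :
  (forall l, (values R p l #<= `I_(g l))%card) -> obeys (possibilities R p) g.
Proof.
move=> v l; apply: card_le_trans (v l); apply: subset_card_le => m [t [_ tl [r [rp H]]]].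
exists r; split=> //; have := H l; rewrite size_rcons nth_rcons -tl ltnn eqxx.
by apply; exact: ltnSn.
Qed.

Lemma in_possibilities tau n p q x : sacks_le q p -> is_real_sequence tau q ->
  is_value tau n x q -> in_branches (possibilities (value_at tau n) p) x q.
Proof.
move=> qp tq xv; split=> [|k r rq]; first exact: sequence_value_real tq xv.
have Rq := value_at_real n tq.
have [r' r'r H] := real_dec_initial k (real_below_le rq Rq).
have r'q := sacks_le_trans r'r rq.
(* Values are chosen at all levels at once, with the dummy value 0 from [k] on. *)
have [F FP] := @choice _ _ (fun l m => l < k -> value_at tau n l m r')
  (fun l => if pselect (l < k) is left lk then
     let: ex_intro m h := H l lk in ex_intro _ m (fun _ => h)
     else ltac:(by exists 0)).
exists r'; split=> //; exists (mkseq F k); split.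
  split; last by rewrite size_mkseq.
  exists r'; split; first exact: sacks_le_trans qp.
  by rewrite size_mkseq => i ik; rewrite nth_mkseq //; exact: FP.
move=> i r1 r1r' ik; rewrite nth_mkseq //; apply: mem_persistent r1r' _.
by apply: (FP i ik x r' (@sacks_le_refl r')); exact: mem_persistent r'q xv.
Qed.

Lemma branch_value T x p l : in_branches T x p -> exists2 q, sacks_le q p &
  exists t, [/\ T t, size t = l.+1 &
    f_mem (opair (nat_check l) (nat_check (nth 0 t l))) x q].
Proof.
move=> [_ /(_ l.+1 p (@sacks_le_refl p))[q [qp [t [[Tt tl] H]]]]].
by exists q => //; exists t; split=> //; exact: H (@sacks_le_refl q) (ltnSn l).
Qed.

(** At the separating level [x] would take a value possible below [p] and also one possible below
    [p'], and these differ. *)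
Lemma separated_branches R p R' p' x q : separated R p R' p' ->
  in_branches (possibilities R p) x q -> ~ in_branches (possibilities R' p') x q.
Proof.
move=> [l sep] /[dup] [[xr _]] b b'.
have [r rq [t [[r1 [r1p H]] tl tx]]] := branch_value l b.
have b'r : in_branches (possibilities R' p') x r.
  split; first exact: is_function_persistent rq xr.
  by apply: all_persistent rq b'.2 => ?; exact: ex_persistent.
have [r' r'r [t' [[r1' [r1p' H']] tl' tx']]] := branch_value l b'r.
have xr' := is_function_persistent (sacks_le_trans r'r rq) xr.
apply: sep r1p r1p' (H l _) (H' l _) _; rewrite ?tl ?tl' //.
exact: real_value_inj xr' (mem_persistent r'r tx) tx'.
Qed.

Lemma in_branches_persistent T x : persistent (in_branches T x).
Proof.
apply: and_persistent; first exact: is_function_persistent.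
by apply: all_persistent => ?; exact: ex_persistent.
Qed.

(** The tree consists of the initial segments of [x], a fact of the ground model, so the conclusion
    holds at any [q], whether or not it is below [p]. *)
Lemma decided_only_branch R p x q : real_below p R -> decided R p x ->
  only_branch (possibilities R p) x q.
Proof.
move=> Rp dx y; split=> r rq.
- move=> yb; apply: real_eq yb.1 (@real_check_real x r) _ => i r1 r1r.
  have [r2 r21 [t [[r3 [r3p H]] tl ty]]] := branch_value i (in_branches_persistent r1r yb).
  exists r2 => //; exists (x i); split; last exact: real_check_value.
  by rewrite -(dx i _ r3 r3p (H i _)) // tl.
- move=> /eq_sym_forced e; split=> [|k]; first exact: is_function_eql e (@real_check_real x r).
  apply: (@ex_intro_forced _ _ (mkseq x k)) => r1 r1r; split.
    split; last by rewrite size_mkseq.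
    have [s sp H] := real_dec_initial k Rp.
    exists s; split=> // i; rewrite size_mkseq => ik; rewrite nth_mkseq //.
    by have [m sm] := H i ik; rewrite -(dx i m s sp sm).
  move=> i r2 r2r1 ik; rewrite nth_mkseq //.
  apply: mem_eqr (eq_persistent (sacks_le_trans r2r1 r1r) e) _; exact: real_check_value.
Qed.

(** A condition forcing [t] for one real can be strengthened to decide the other equally far, with
    the same values. *)
Lemma coincide_possibilities R R' p : real_below p R -> real_below p R' ->
  coincide R R' p -> possibilities R p = possibilities R' p.
Proof.
have H R1 R2 : real_below p R1 -> real_below p R2 -> coincide R1 R2 p ->
    possibilities R1 p `<=` possibilities R2 p.
  move=> R1p R2p c t [r [rp H]].
  have [q qr H'] := real_dec_initial (size t) (real_below_le rp R2p).
  have qp := sacks_le_trans qr rp; exists q; split=> // i ilt.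
  have [m qm] := H' i ilt.
  by rewrite (c _ _ _ q qp (real_mono R1p qr (H i ilt)) qm).
move=> Rp Rp' c; apply/seteqP; split; first exact: H.
by apply: H => // l m m' r rp rm rm'; apply/esym; exact: c rm' rm.
Qed.

Lemma coincide_eq tau n n' x x' p q : sacks_le q p -> is_real_sequence tau q ->
  coincide (value_at tau n) (value_at tau n') p ->
  is_value tau n x q -> is_value tau n' x' q -> f_eq x x' q.
Proof.
move=> qp tq c xv xv'; apply: (real_eq (sequence_value_real tq xv) (sequence_value_real tq xv')).
move=> i r rq; have tr := is_function_persistent rq tq.
have [r1 [r1r [m vm]]] := real_dec (value_at_real n tr) i (@sacks_le_refl r).
have tr1 := is_function_persistent r1r tr.
have [r2 [r2r1 [m' vm']]] := real_dec (value_at_real n' tr1) i (@sacks_le_refl r1).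
have r2r := sacks_le_trans r2r1 r1r; have r2q := sacks_le_trans r2r rq.
have vm2 := real_mono (value_at_real n tr) r2r1 vm.
exists r2 => //; exists m; split; first by apply: vm2 (@sacks_le_refl r2) (mem_persistent r2q xv).
rewrite (c i m m' r2 (sacks_le_trans r2q qp) vm2 vm').
exact: vm' (@sacks_le_refl r2) (mem_persistent r2q xv').
Qed.

(** Induction on [N]: the value [N] is taken at finitely many pairs, so past the last of them the
    bound improves by one. *)
Lemma finite_to_one_unbounded (f : nat -> nat -> nat) :
  finite_to_one (fun il : nat * nat => f il.1 il.2) ->
  forall i N, exists L, forall l, L <= l -> N <= f i l.
Proof.
move=> ffin i; elim=> [|N [L LP]]; first by exists 0.
have /finite_seqP[s sE] := ffin N.
exists (maxn L (\max_(il <- s) il.2).+1) => l; rewrite geq_max => /andP[Ll sl].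
rewrite ltn_neqAle LP // andbT; apply/eqP => Nf.
have : [set` s] (i, l) by rewrite -sE.
by move=> /= ils; move: sl; rewrite ltnNge (@leq_bigmax_seq _ s xpredT snd (i, l)).
Qed.

(** * The wrapper *)

(** A condition deciding [x] is compatible with some [Q s]; being settled, [Q s] must itself decide
    [x]. So each word gives at most one real. *)
Lemma settled_finite p R k Q q : real_below p R -> sacks_le q p -> below Q q ->
  predense_below k q Q -> (forall s, size s = k -> settled R (Q s)) ->
  finite_set [set x | exists r, sacks_le r q /\ decided R r x].
Proof.
move=> Rp qp Qq pre st.
have [F FP] : {F : seq bool -> nat -> nat & forall s x, decided R (Q s) x -> x = F s}.
  apply: (@choice _ _ (fun s y => forall x, decided R (Q s) x -> x = y)) => s.
  have [[y yd]|nd] := pselect (exists y, decided R (Q s) y).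
    exists y => x xd; apply: decided_inj xd yd.
    exact: real_below_le (sacks_le_trans (Qq s) qp) Rp.
  by exists id => x xd; case: nd; exists x.
apply: (@sub_finite_set _ _ (F @` [set` words k])); last exact/finite_image/finite_seq.
move=> x [r [rq dx]]; have [s [sk [r' [r'r r's]]]] := pre r rq.
exists s; first by rewrite /= mem_words sk.
have [[y yd]|nd] := st s sk; last by have := nd x r' r's (decided_le r'r dx).
rewrite -(FP s y yd); apply: decided_inj (decided_le r's yd) (decided_le r'r dx).
exact: real_below_le (sacks_le_trans r'r (sacks_le_trans rq qp)) Rp.
Qed.

Lemma shrink_wrapper_exists (f : nat -> nat -> nat) (eta : nat -> {fset nat})
    (Phi : seq bool * nat -> nat) p tau :
  (forall i l, 0 < f i l) -> finite_to_one (fun il : nat * nat => f il.1 il.2) ->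
  set_surj setT unordered_pairs eta -> is_real_sequence tau p ->
  exists2 q, sacks_le q p & exists W, is_shrink_wrapper f eta Phi W tau q.
Proof.
move=> f_gt0 f_fin eta_surj tp.
pose R := value_at tau.
have [Q [Qp Qq pre sl sp]] := @slots_fusion p R eta (fun s n => f (Phi (s, n)))
  (fun n => value_at_real n tp) (fun s n => f_gt0 _)
  (fun s n => finite_to_one_unbounded f_fin _).
exists (Q [::]) => //; have tq := is_function_persistent Qp tp.
have RQ s n : real_below (Q s) (R n) := real_below_le (Qq s) (value_at_real n tq).
pose W := Wrapper (fun k n (s : k.-tuple bool) => possibilities (R n) (Q s))
  (fun n => [set x | exists r, sacks_le r (Q [::]) /\ decided (R n) r x]).
exists W; split=> //; split; [split|split].
(* Finiteness of I(n) needs some stage that treats [n]; the pair {n, n+1} provides one. *)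
- move=> n; have [k _ kn] : exists2 k, [set: nat] k & eta k = [fset n; n.+1]%fset.
    by apply: eta_surj; rewrite /unordered_pairs /= cardfs2 neq_ltn ltnSn.
  apply: (settled_finite (value_at_real n tp) Qp Qq (pre k)) => s sk.
  by apply: (sl s n _).2; rewrite sk kn !inE eqxx.
- move=> k n s nk; split.
  + exact: possibilities_tree.
  + exact: possibilities_leafless.
  + by apply: possibilities_obeys; apply: (sl s n _).1; rewrite size_tuple.
- move=> k n q0 q0q nk q1 q1q0.
  (* A condition below some [Q s] forces the real into the tree attached to that [s]. *)
  have [s [/eqP sk [r [rq rs]]]] := pre k q1 (sacks_le_trans q1q0 q0q).
  exists r; split=> //; exists (Tuple sk) => x r' r'r xv.
  apply: in_possibilities xv; first exact: sacks_le_trans rs.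
  apply: is_function_persistent tq.
  exact: sacks_le_trans r'r (sacks_le_trans rq (sacks_le_trans q1q0 q0q)).
move=> k n1 n2 q0 q0q kn s1 s2 x1 x2 q1 q1q0 v1 q2 q2q1 v2 /=.
have n1k : n1 \in eta k by rewrite kn !inE eqxx.
have n2k : n2 \in eta k by rewrite kn !inE eqxx orbT.
have pair s n s' n' : size s = k -> size s' = k -> n \in eta k -> n' \in eta k ->
    slot_pair R s n s' n' Q by move=> <- ss' nk nk'; apply: sp => //; rewrite ss'.
have k1 := size_tuple s1; have k2 := size_tuple s2.
have both_decided : (exists x, decided (R n1) (Q s1) x /\ decided (R n2) (Q s2) x) ->
    forall q', f_ex (fun x => f_and (f_ground (wrap_I W n1 x /\ wrap_I W n2 x))
      (f_and (only_branch (possibilities (R n1) (Q s1)) x)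
             (only_branch (possibilities (R n2) (Q s2)) x))) q'.
  move=> [x [d1 d2]] q'; apply: (@ex_intro_forced _ _ x) => r _; split.
    by split; [exists (Q s1) | exists (Q s2)].
  by split; exact: decided_only_branch.
have [sep|dec|[s12 c]] := pair s1 n1 s2 n2 k1 k2 n1k n2k.
- apply: or_intror_forced => r rq; apply: or_intror_forced => r' r'r y r1 r1r' [b1 b2].
  exact: separated_branches sep b1 b2.
- by apply: or_intror_forced => r rq; apply: or_introl_forced => r' r'r; exact: both_decided.
(* With one word and coinciding reals, a decided real falls under case (b); case (a) is kept for
   undecided reals, as its proof uses undecidedness. *)
have [[x d1]|nd] := pselect (exists x, decided (R n1) (Q s1) x).
  apply: or_intror_forced => r rq; apply: or_introl_forced => r' r'r.
  apply: both_decided; exists x; split=> // l m r1; rewrite -s12 => r1s rm.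
  have [r2 [r2r1 [m' rm']]] := real_dec (RQ s1 n1) l r1s.
  have r2s := sacks_le_trans r2r1 r1s.
  by rewrite -(c _ _ _ r2 r2s rm' (real_mono (RQ s1 n2) r2r1 rm)) (d1 _ _ _ r2s rm').
have TE := coincide_possibilities (RQ s1 n1) (RQ s1 n2) c.
have nd2 x : ~ decided (R n2) (Q s1) x.
  move=> d2; apply: nd; exists x => l m r rs rm.
  have [r2 [r2r [m' rm']]] := real_dec (RQ s1 n2) l rs.
  have r2s := sacks_le_trans r2r rs.
  by rewrite (c _ _ _ r2 r2s (real_mono (RQ s1 n1) r2r rm) rm') (d2 _ _ _ r2s rm').
apply: or_introl_forced => r rq; rewrite -s12 -TE; split.
  by move=> y; split=> ? ?.
move=> r1 r1r xb; apply: eq_dense_closed => r2 r2r1.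
have r2q2 := sacks_le_trans r2r1 (sacks_le_trans r1r rq).
have r2q1 := sacks_le_trans r2q2 q2q1.
have r2q := sacks_le_trans r2q1 (sacks_le_trans q1q0 q0q).
have [r3 [r3r2 xb3]] := xb r2 r2r1.
have r3q := sacks_le_trans r3r2 r2q.
(* Strengthen to a condition below a single [Q s]; the reals coincide below [Q s1], so it remains to
   identify [s] with [s1]. *)
have [s [sk [r4 [r4r3 r4s]]]] := pre k r3 r3q.
have r4q := sacks_le_trans r4r3 r3q; have r42 := sacks_le_trans r4r3 r3r2.
have t4 := is_function_persistent r4q tq.
have v14 := mem_persistent (sacks_le_trans r42 r2q1) v1.
have v24 := mem_persistent (sacks_le_trans r42 r2q2) v2.
exists r4; first exact: r42.
have b1 := in_possibilities r4s t4 v14; have b2 := in_possibilities r4s t4 v24.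
suff ss1 : s = s1 by apply: (coincide_eq _ t4 c v14 v24); rewrite -ss1.
(* The real is a branch of the trees at [s] and at [s1], which rules out separation; a common
   decided value contradicts undecidedness at [s1]. Only [s = s1] is left. *)
case: xb3 => /(in_branches_persistent r4r3).
- rewrite TE => b.
  have [sep|[x [_ /nd2]]|[]] // := pair s n1 s1 n2 sk k1 n1k n2k.
  by case: (separated_branches sep b1 b).
- move=> b.
  have [sep|[x [_ d]]|[]] // := pair s n2 s1 n1 sk k1 n2k n1k.
    by case: (separated_branches sep b2 b).
  by case: nd; exists x.
Qed.

Theorem theorem3p7
    (f : nat -> nat -> nat)
    (f_gt0 : forall i l, 0 < f i l)
    (f_computable : computable2 f)
    (f_fin : finite_to_one (fun il : nat * nat => f il.1 il.2))
    (eta : nat -> {fset nat})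
    (eta_bij : set_bij setT unordered_pairs eta)
    (eta_computable : computable_pairs eta)
    (Phi : seq bool * nat -> nat)
    (Phi_fin : finite_to_one Phi) :
  (forall (p : sacks) (tau : name),
     p ||- is_real_sequence tau ->
     exists q : sacks, sacks_le q p /\
       exists W : wrapper, q ||- is_shrink_wrapper f eta Phi W tau) /\
  (sacks_top ||- shrink_wrapping_property f eta Phi).
Proof.
have [_ _ eta_surj] := eta_bij.
split=> [p tau tp|tau p _ tp q qp].
  have [q qp [W qW]] := @shrink_wrapper_exists f eta Phi p tau f_gt0 f_fin eta_surj tp.
  by exists q; split=> //; exists W.
(* The existential over wrappers asks for witnesses densely, so the construction is repeated below
   each [q]. *)
have tq := is_function_persistent qp tp.
have [r rq [W rW]] := @shrink_wrapper_exists f eta Phi q tau f_gt0 f_fin eta_surj tq.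
by exists r; split=> //; exists W.
Qed.
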